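(* Let $(T,o)$ be a rooted directed tree and let $G$ be a finite directed graph. There exist functions $F_x:V(G)\to\mathbb R_{\ge0}$, $x\in V(T)$, such that $$\hom((T,o),(G,v))=F_o(v),\qquad v\in V(G),$$ and they are computed recursively as follows: if $x$ is a leaf of the rooted tree $T$ (a vertex with no children), then $F_x\equiv1$; otherwise, for all $v\in V(G)$, $$F_x(v)=\prod_{c\in\mathrm{ch}^{\mathrm{out}}(x)}(A_{\mathrm{out}}F_c)(v)\cdot\prod_{c\in\mathrm{ch}^{\mathrm{in}}(x)}(A_{\mathrm{in}}F_c)(v).$$
   Context: A digraph (directed graph) is a finite directed simple loopless graph: at most one arc for each ordered pair of distinct vertices (opposite arcs are allowed). A rooted directed tree $(T,o)$ is an orientation of a finite undirected tree with a distinguished root $o$; the children of $x$ are its neighbours in the underlying tree lying below $x$ (farther from $o$). $\mathrm{ch}^{\mathrm{out}}(x)$ is the set of children $c$ of $x$ such that $x\to c$ is an arc of $T$, and $\mathrm{ch}^{\mathrm{in}}(x)$ is the set of children $c$ of $x$ such that $c\to x$ is an arc of $T$. $\hom((T,o),(G,v))$ is the number of digraph homomorphisms $\varphi:T\to G$ (maps sending arcs to arcs, preserving direction) with $\varphi(o)=v$. For $f:V(G)\to\mathbb R$, $(A_{\mathrm{out}}f)(v):=\sum_{u:\,v\to u}f(u)$ and $(A_{\mathrm{in}}f)(v):=\sum_{u:\,u\to v}f(u)$, sums over arcs of $G$. Empty products equal $1$. *)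

(* Defs.v *)
From mathcomp Require Import all_boot all_order all_algebra.
From mathcomp Require Import reals.

Set Implicit Arguments.
Unset Strict Implicit.
Unset Printing Implicit Defensive.

Import Order.TTheory GRing.Theory Num.Theory.
Local Open Scope ring_scope.

Record digraph := Digraph {
  vertex :> finType;
  arc : rel vertex;
  arc_irrefl : irreflexive arc }.

Definition uedge (T : digraph) : rel T := fun x y => arc x y || arc y x.

(* [ucycle e c] also holds for [:: x; y] when x and y are joined by an edge of
   a symmetric e, so genuine cycles are those with at least 3 vertices. *)
Definition acyclic (V : finType) (e : rel V) : Prop :=
  forall c : seq V, ucycle e c -> (size c <= 2)%N.

(* For e symmetric and irreflexive, i.e. an undirected simple graph. *)
Definition is_tree (V : finType) (e : rel V) : Prop :=
  [/\ (0 < #|V|)%N, forall x y : V, connect e x y & acyclic e].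

(* An orientation keeps exactly one direction of each undirected edge. *)
Definition directed_tree (T : digraph) : Prop :=
  (forall x y : T, arc x y -> ~~ arc y x) /\ is_tree (uedge (T := T)).

(* The least length of an e-walk from x to y; the value is #|V| when y is not
   reachable from x. *)
Definition gdist (V : finType) (e : rel V) (x y : V) : nat :=
  \big[minn/#|V|]_(n < #|V| |
    [exists p : n.-tuple V, path e x p && (last x p == y)]) n.

Definition children (T : digraph) (o x : T) : {set T} :=
  [set c | uedge x c
           && (gdist (uedge (T := T)) o x < gdist (uedge (T := T)) o c)%N].

Definition ch_out (T : digraph) (o x : T) : {set T} :=
  [set c in children o x | arc x c].

Definition ch_in (T : digraph) (o x : T) : {set T} :=
  [set c in children o x | arc c x].

Definition is_hom (T G : digraph) (phi : {ffun T -> G}) : bool :=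
  [forall x, forall y, arc x y ==> arc (phi x) (phi y)].

Definition hom_count (T : digraph) (o : T) (G : digraph) (v : G) : nat :=
  #|[set phi : {ffun T -> G} | is_hom phi && (phi o == v)]|.

Definition A_out (R : realType) (G : digraph) (f : G -> R) (v : G) : R :=
  \sum_(u : G | arc v u) f u.

Definition A_in (R : realType) (G : digraph) (f : G -> R) (v : G) : R :=
  \sum_(u : G | arc u v) f u.

(* Main.v *)
Require Import Defs.
From mathcomp Require Import all_boot all_order all_algebra.
From mathcomp Require Import reals.

Import Order.TTheory GRing.Theory Num.Theory.
Local Open Scope ring_scope.

(** The homomorphism count is a sum, over all maps phi from the tree to G that
    send the root to v, of a product of one 0/1 factor per tree edge.  Each
    vertex c other than the root lies on exactly one edge going up, so the
    product may be indexed by these c, the factor of c being a function of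
    phi (par c) and phi c.  Now sum over the values of phi one vertex at a time,
    the deepest first: when phi y is summed over, the only remaining factors that
    depend on it are the edge factor of y and the results already obtained for
    the children of y, whose product is F y (phi y) by the recursion.  The
    distributive law thus turns the sum over phi y into a factor which depends on
    phi (par y) only, and once all vertices but the root are treated, F o v is
    left.  [sum_maps_recursion] is this computation, for arbitrary edge weights
    and any parent function that decreases a rank.

    The parent function comes from the distance to the root.  Distances decrease
    along some edge out of every vertex other than the root, by connectedness
    ([gdist_descent]); acyclicity leaves room for at most one neighbour that is
    not farther from the root ([closer_neighbour_unique]), so parents are unique
    and no edge joins two vertices at equal distance ([edge_parent]). *)

(** * Summing edge weights over the maps from a rooted tree *)

(** Fuel replaces well-founded recursion along the tree: [fuel_irrelevance]
    shows that the value at [x] does not depend on [k] once [k] is large. *)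
Fixpoint subtree_sum {R : comNzSemiRingType} {T G : finType} (o : T)
    (par : T -> T) (W : T -> G -> G -> R) (k : nat) (x : T) (v : G) : R :=
  if k is k'.+1 then
    \prod_(c | (c != o) && (par c == x))
      \sum_u W c v u * subtree_sum o par W k' c u
  else 1.

Lemma fuel_irrelevance (R : comNzSemiRingType) (T G : finType) (o : T)
    (par : T -> T) (W : T -> G -> G -> R) (d : T -> nat) (N : nat) :
    (forall c, c != o -> (d (par c) < d c)%N) -> (forall x, d x <= N)%N ->
  forall k l x v, (N < k + d x)%N -> (N < l + d x)%N ->
  subtree_sum o par W k x v = subtree_sum o par W l x v.
Proof.
move=> dpar dN; elim=> [|k IHk] [|l] x v; rewrite ?add0n 1?(ltnNge N (d x)) ?dN //.
rewrite !addSnnS => hk hl /=.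
apply: eq_bigr => c /andP[cNo /eqP pcx].
have dxc : (d x < d c)%N by rewrite -pcx dpar.
by apply: eq_bigr => u _; congr (_ * _); apply: IHk;
  [apply: leq_trans hk _ | apply: leq_trans hl _]; rewrite leq_add2l.
Qed.

Lemma subtree_sum_rec (R : comNzSemiRingType) (T G : finType) (o : T)
    (par : T -> T) (W : T -> G -> G -> R) (d : T -> nat) (N : nat) :
    (forall c, c != o -> (d (par c) < d c)%N) -> (forall x, d x <= N)%N ->
  forall x v, subtree_sum o par W N.+1 x v =
    \prod_(c | (c != o) && (par c == x))
      \sum_u W c v u * subtree_sum o par W N.+1 c u.
Proof.
move=> dpar dN x v; apply: eq_bigr => c /andP[cNo _].
have dc0 : (0 < d c)%N := leq_ltn_trans (leq0n _) (dpar _ cNo).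
apply: eq_bigr => u _; congr (_ * _).
by apply: (fuel_irrelevance _ _ _ _ _ _ d N) => //;
  rewrite -[ltnLHS]addn0 ?addSn ?ltnS ?leq_add2l ?ltn_add2l.
Qed.

Lemma subtree_sum_ge0 (R : numDomainType) (T G : finType) (o : T)
    (par : T -> T) (W : T -> G -> G -> R) :
    (forall c u v, 0 <= W c u v) ->
  forall k x v, 0 <= subtree_sum o par W k x v.
Proof.
move=> W0; elim=> [|k IHk] x v /=; first exact: ler01.
by apply: prodr_ge0 => c _; apply: sumr_ge0 => u _; apply: mulr_ge0.
Qed.

Definition update {T G : finType} (phi : {ffun T -> G}) (y : T) (u : G) :
  {ffun T -> G} := [ffun x => if x == y then u else phi x].

Definition pinned {T G : finType} (S : {set T}) (v : G) (phi : {ffun T -> G}) :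
  bool := [forall x in S, phi x == v].

Lemma sum_pinned (R : nmodType) (T G : finType) (S : {set T}) (y : T) (v : G)
    (E : {ffun T -> G} -> R) : y \notin S ->
  \sum_(phi | pinned S v phi) E phi =
  \sum_(phi | pinned (y |: S) v phi) \sum_u E (update phi y u).
Proof.
move=> yS.
have upd_in phi u x : x \in S -> update phi y u x = phi x.
  by move=> xS; rewrite ffunE; case: eqP => // xy; rewrite -xy xS in yS.
rewrite (partition_big (fun phi => update phi y v) (pinned (y |: S) v)) /=.
  apply: eq_bigr => phi /forall_inP phiP.
  rewrite (reindex_onto (update phi y) (fun psi => psi y)) /=.
    apply: eq_bigl => u; apply/andP; split; last by rewrite ffunE eqxx.
    apply/andP; split.
      apply/forall_inP => x xS.
      by rewrite upd_in // phiP // in_setU1 xS orbT.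
    apply/eqP/ffunP => x; rewrite !ffunE; case: eqP => // ->.
    by apply/esym/eqP/phiP; rewrite setU11.
  move=> psi /andP[_ /eqP <-]; apply/ffunP => x; rewrite !ffunE.
  by case: eqP => [->|].
move=> phi /forall_inP phiP; apply/forall_inP => x.
case/setU1P => [->|xS]; first by rewrite ffunE eqxx.
by rewrite upd_in // phiP.
Qed.

(** The set [S] holds the vertices already summed over, whose values are pinned
    to [v] so that the sum remains over maps from the whole of [T].  Each vertex
    of [S] whose parent is outside [S] contributes the result of its
    summation. *)
Definition partial_sum {R : comNzSemiRingType} {T G : finType} (o : T)
    (par : T -> T) (W : T -> G -> G -> R) (F : T -> G -> R) (v : G)
    (S : {set T}) : R :=
  \sum_(phi : {ffun T -> G} | pinned S v phi && (phi o == v))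
    (\prod_(c | (c != o) && (c \notin S)) W c (phi (par c)) (phi c)) *
    \prod_(c | (c \in S) && (par c \notin S)) \sum_u W c (phi (par c)) u * F c u.

(** The factors that involve the value at [y] are its edge weight and the
    contributions of its children, so summing over that value produces exactly
    the contribution of [y]. *)
Lemma partial_sum_peel (R : comNzSemiRingType) (T G : finType) (o : T)
    (par : T -> T) (W : T -> G -> G -> R) (F : T -> G -> R) (v : G)
    (S : {set T}) (y : T) :
    (forall x u, F x u = \prod_(c | (c != o) && (par c == x))
                           \sum_w W c u w * F c w) ->
    o \notin S -> y \notin S -> y != o -> par y != y -> par y \notin S ->
    (forall c, c != o -> par c = y -> c \in S) ->
  partial_sum o par W F v S = partial_sum o par W F v (y |: S).
Proof.
move=> FE oS yS yo pyy pyS chS; rewrite /partial_sum.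
rewrite big_mkcondr (sum_pinned _ _ _ S y) //= [RHS]big_mkcondr /=.
apply: eq_bigr => phi _.
have updo u : update phi y u o = phi o by rewrite ffunE eq_sym (negPf yo).
under eq_bigr do rewrite updo.
case: eqP => _; last by rewrite big1.
have updN u x : x != y -> update phi y u x = phi x.
  by move=> xy; rewrite ffunE (negPf xy).
have updy u : update phi y u y = u by rewrite ffunE eqxx.
rewrite [X in _ = _ * X](bigD1 y) /=; last by rewrite setU11 in_setU1 negb_or pyy.
rewrite mulrCA mulr_suml; apply: eq_bigr => u _.
rewrite (bigD1 y) /= ?yo // updy updN // -!mulrA; congr (_ * _).
rewrite [X in _ * X = _](bigID (fun c => par c == y)) /= [RHS]mulrCA; congr (_ * _).
  apply: eq_big => [c|c /andP[/andP[cNo cS] cy]].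
    by rewrite in_setU1 negb_or -andbA [(c != y) && _]andbC.
  rewrite (updN _ c) // updN //.
  by apply: contraNneq cS; apply: chS.
congr (_ * _).
  rewrite FE; apply: eq_big => [c|c /andP[_ /eqP ->]]; last by rewrite updy.
  case: (par c =P y) => pcy; rewrite ?andbF // !andbT pcy yS andbT.
  apply/idP/idP => [cS|cNo]; last exact: chS.
  by apply: contraNneq oS => <-.
apply: eq_big => [c|c /andP[_ pcy]]; last by rewrite updN.
rewrite !in_setU1 negb_or; case: (eqVneq c y) => [->|_] /=.
  by rewrite (negPf yS) andbF.
by rewrite andbT -andbA [(par c != y) && _]andbC.
Qed.

(** The deepest vertex outside [S] and distinct from the root has all its
    children in [S], so it can be summed over next.  When the root alone is
    left, the only map in the sum is constant and its weight is the recursion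
    formula for [F o v]. *)
Lemma partial_sum_const (R : comNzSemiRingType) (T G : finType) (o : T)
    (par : T -> T) (W : T -> G -> G -> R) (F : T -> G -> R) (v : G)
    (d : T -> nat) :
    (forall c, c != o -> (d (par c) < d c)%N) ->
    (forall x u, F x u = \prod_(c | (c != o) && (par c == x))
                           \sum_w W c u w * F c w) ->
  forall S : {set T}, o \notin S ->
    (forall c, c != o -> par c \in S -> c \in S) ->
  partial_sum o par W F v S = F o v.
Proof.
move=> dpar FE S.
have [n] := ubnP #|~: S|; elim: n => // n IHn in S * => cardS oS closedS.
have [z /andP[zo zS]|all_in] := pickP (fun z => (z != o) && (z \notin S)).
  have [y /andP[yo yS] ymax] := arg_maxnP (P := fun y => (y != o) && (y \notin S))
                                          d (introT andP (conj zo zS)).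
  have chS c : c != o -> par c = y -> c \in S.
    move=> cNo pcy; apply: contraT => cS.
    have := ymax c; rewrite cNo cS => /(_ isT) dcy.
    by have := leq_trans (dpar _ cNo) dcy; rewrite pcy ltnn.
  have pyS : par y \notin S by apply: contra yS; apply: closedS.
  have pyy : par y != y.
    by apply/eqP => pyy; have := dpar _ yo; rewrite pyy ltnn.
  rewrite (partial_sum_peel _ _ _ _ _ _ _ _ _ y) //; apply: IHn.
  - rewrite -ltnS; apply: leq_trans cardS; rewrite ltnS; apply/proper_card/properP.
    split; first by rewrite setCS subsetUr.
    by exists y; rewrite inE ?yS // setU11.
  - by rewrite in_setU1 negb_or eq_sym yo.
  move=> c cNo; rewrite !in_setU1 => /predU1P[pcy|pcS].
    by rewrite (chS c) ?orbT.
  by rewrite (closedS c) ?orbT.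
have inS c : (c \in S) = (c != o).
  have := all_in c; case: (eqVneq c o) => [->|_] /=; first by rewrite (negPf oS).
  by move/negbFE.
rewrite /partial_sum (big_pred1 [ffun=> v]) => [|phi].
  rewrite big_pred0 => [|c]; last by rewrite inS andbN.
  rewrite mul1r FE; apply: eq_big => [c|c _]; first by rewrite !inS negbK.
  by rewrite ffunE.
apply/andP/eqP => [[/forall_inP phiP /eqP phio]|->].
  apply/ffunP => x; rewrite ffunE.
  by have [->//|xo] := eqVneq x o; apply/eqP/phiP; rewrite inS.
by split; [apply/forall_inP => x _|]; rewrite ffunE.
Qed.

Lemma sum_maps_recursion (R : comNzSemiRingType) (T G : finType) (o : T)
    (par : T -> T) (W : T -> G -> G -> R) (F : T -> G -> R) (d : T -> nat)
    (v : G) :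
    (forall c, c != o -> (d (par c) < d c)%N) ->
    (forall x u, F x u = \prod_(c | (c != o) && (par c == x))
                           \sum_w W c u w * F c w) ->
  \sum_(phi : {ffun T -> G} | phi o == v)
     \prod_(c | c != o) W c (phi (par c)) (phi c) = F o v.
Proof.
move=> dpar FE.
rewrite -(partial_sum_const _ _ _ _ _ _ _ v _ dpar FE set0) ?inE //; last first.
  by move=> c _; rewrite inE.
apply: eq_big => [phi|phi _].
  suff -> : pinned set0 v phi by [].
  by apply/forall_inP => x; rewrite inE.
rewrite [X in _ = _ * X]big_pred0 => [|c]; last by rewrite inE.
by rewrite mulr1; apply: eq_bigl => c; rewrite inE andbT.
Qed.

(** * Distances and parents in a rooted tree *)

Lemma gdist_le_size (V : finType) (e : rel V) (x y : V) (p : seq V) :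
  path e x p -> last x p = y -> (size p < #|V|)%N -> (gdist e x y <= size p)%N.
Proof.
move=> xp lxp szp.
rewrite /gdist; move: (mem_index_enum (Ordinal szp)).
elim: (index_enum _) => // n r IHr; rewrite in_cons big_cons.
case/predU1P => [<-|/IHr le_p]; last by case: ifP => _; rewrite // geq_min le_p orbT.
rewrite ifT ?geq_minl //.
by apply/existsP; exists (in_tuple p); rewrite xp lxp eqxx.
Qed.

Lemma gdist_refl (V : finType) (e : rel V) (x : V) : gdist e x x = 0%N.
Proof.
apply/eqP; rewrite -leqn0; apply: (gdist_le_size _ _ _ _ [::]) => //.
by apply/card_gt0P; exists x.
Qed.

Lemma gdist_le_card (V : finType) (e : rel V) (x y : V) :
  (gdist e x y <= #|V|)%N.
Proof.
by rewrite /gdist; elim/big_ind: _ => // [a b _|i _]; [rewrite geq_min orbC => ->|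
  exact: ltnW].
Qed.

Lemma gdist_attained (V : finType) (e : rel V) (x y : V) : connect e x y ->
  exists p, [/\ path e x p, last x p = y, size p = gdist e x y
              & (size p < #|V|)%N].
Proof.
case/connectP => q0 /shortenP[q xq uq _] lq.
have szq : (size q < #|V|)%N.
  by rewrite -[_.+1]/(size (x :: q)) -(card_uniqP uq) max_card.
have lt_d := leq_ltn_trans (gdist_le_size _ _ _ _ _ xq (esym lq) szq) szq.
have: gdist e x y = #|V| \/ exists p, [/\ path e x p, last x p = y &
                                        size p = gdist e x y].
  rewrite /gdist; elim/big_ind: _ => [|a b Ha Hb|i /existsP[p /andP[xp /eqP lp]]].
  - by left.
  - by rewrite /minn; case: ifP.
  - by right; exists p; rewrite size_tuple.
case=> [dV|[p [xp lp szp]]]; first by rewrite dV ltnn in lt_d.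
by exists p; rewrite szp.
Qed.

Lemma gdist_descent (V : finType) (e : rel V) (o x : V) :
  connect e o x -> x != o ->
  exists2 y, e y x & (gdist e o y < gdist e o x)%N.
Proof.
case/gdist_attained => p [+ + <- +]; case/lastP: p => [|p z] /=.
  by move=> _ ->; rewrite eqxx.
rewrite rcons_path last_rcons size_rcons => /andP[op ez] <- szp _.
by exists (last o p); rewrite // ltnS gdist_le_size // ltnW.
Qed.

(** Going down in distance, two such neighbours would both be joined to the root
    without passing through [c], hence to each other, and [c] would close a
    cycle. *)
Lemma closer_neighbour_unique (V : finType) (e : rel V) (o c p q : V) :
    symmetric e -> irreflexive e -> is_tree e ->
    e c p -> e c q ->
    (gdist e o p <= gdist e o c)%N -> (gdist e o q <= gdist e o c)%N ->
  p = q.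
Proof.
move=> esym eirr [_ econ eacyc] ecp ecq dp dq.
pose e' := [rel x y | [&& e x y, x != c & y != c]].
have e'sym : connect_sym e'.
  by apply: sym_connect_sym => x y /=; rewrite esym [(x != c) && _]andbC.
have to_root x : x != c -> (gdist e o x <= gdist e o c)%N -> connect e' x o.
  have [n] := ubnP (gdist e o x); elim: n => // n IHn in x * => dn xc dx.
  have [->|xo] := eqVneq x o; first exact: connect0.
  have [y eyx dyx] := gdist_descent _ _ _ _ (econ o x) xo.
  have yc : y != c by apply: contraTneq (leq_trans dyx dx) => ->; rewrite ltnn.
  apply: (connect_trans (y := y)); first by apply: connect1; rewrite /= esym eyx xc.
  apply: IHn => //; first exact: leq_trans dyx dn.
  exact: leq_trans (ltnW dyx) dx.
have neqc x : e c x -> x != c by apply: contraTneq => ->; rewrite eirr.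
have: connect e' p q.
  by rewrite (connect_trans (to_root p _ dp)) ?neqc // e'sym to_root ?neqc.
case/connectP => s0 /shortenP[s ps us _] qE.
have sub : path e p s by apply: sub_path ps => x y /and3P[].
have cs : c \notin p :: s.
  rewrite in_cons negb_or eq_sym neqc //=; apply/negP => cs.
  have : all (predC1 c) s.
    elim: (s) (p) ps => //= b r IHr a /andP[/and3P[_ _ ->] /IHr].
    exact.
  by move/allP/(_ c cs); rewrite /= eqxx.
have /eacyc : ucycle e (c :: p :: s).
  by rewrite /ucycle cons_uniq cs us /= andbT rcons_path ecp sub -qE esym ecq.
by case: s qE {ps us sub cs}.
Qed.

Lemma uedge_sym (T : digraph) : symmetric (@uedge T).
Proof. by move=> x y; rewrite /uedge orbC. Qed.

Lemma uedge_irr (T : digraph) : irreflexive (@uedge T).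
Proof. by move=> x; rewrite /uedge arc_irrefl. Qed.

(** The root is its own parent, a default value. *)
Definition parent {T : digraph} (o c : T) : T :=
  odflt c [pick x | c \in children o x].

Lemma childrenE (T : digraph) (o x c : T) : is_tree (@uedge T) ->
  (c \in children o x) = (c != o) && (parent o c == x).
Proof.
move=> treeT; have [_ econ _] := treeT; rewrite /parent.
have uniq_par y z : c \in children o y -> c \in children o z -> y = z.
  rewrite !inE => /andP[ey dy] /andP[ez dz].
  apply: closer_neighbour_unique (uedge_sym T) (uedge_irr T) (treeT) _ _
    (ltnW dy) (ltnW dz); by rewrite uedge_sym.
have [->|cNo] /= := eqVneq c o.
  by rewrite inE gdist_refl ltn0 andbF.
case: pickP => [y cy|none] /=.
  by apply/idP/eqP => [cx|<- //]; apply: uniq_par.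
have [y eyc dyc] := gdist_descent _ _ _ _ (econ o c) cNo.
by have := none y; rewrite inE eyc dyc.
Qed.

Lemma gdist_parent (T : digraph) (o c : T) : is_tree (@uedge T) -> c != o ->
  (gdist (@uedge T) o (parent o c) < gdist (@uedge T) o c)%N.
Proof.
move=> treeT cNo; have : c \in children o (parent o c).
  by rewrite childrenE // cNo eqxx.
by rewrite inE => /andP[].
Qed.

Lemma uedge_parent (T : digraph) (o c : T) : is_tree (@uedge T) -> c != o ->
  uedge (parent o c) c.
Proof.
move=> treeT cNo; have : c \in children o (parent o c).
  by rewrite childrenE // cNo eqxx.
by rewrite inE => /andP[].
Qed.

(** Ends of an edge at equal distance are impossible: the farther-or-equal
    end has its parent as only neighbour that is not farther from the root. *)
Lemma edge_parent (T : digraph) (o x y : T) : is_tree (@uedge T) ->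
  uedge x y -> (y != o) && (parent o y == x) || (x != o) && (parent o x == y).
Proof.
move=> treeT; have [_ econ _] := treeT.
wlog dxy : x y / (gdist (@uedge T) o x <= gdist (@uedge T) o y)%N.
  move=> H; have [/H//|/ltnW/H{}H] :=
    leqP (gdist (@uedge T) o x) (gdist (@uedge T) o y).
  by rewrite uedge_sym orbC.
move=> exy; apply/orP; left; rewrite -childrenE // inE exy /=.
have [yo|yo] := eqVneq y o.
  have xo : x != o.
    by rewrite -yo; apply: contraTneq exy => ->; rewrite uedge_irr.
  have [z _ dz] := gdist_descent _ _ _ _ (econ o x) xo.
  by have := leq_trans dz dxy; rewrite yo gdist_refl.
have <- : parent o y = x; last exact: gdist_parent.
have dpy := ltnW (gdist_parent _ _ _ treeT yo).
have epy := uedge_parent _ _ _ treeT yo.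
by apply: closer_neighbour_unique (uedge_sym T) (uedge_irr T) treeT _ _ dpy dxy;
  rewrite uedge_sym.
Qed.

(** * Homomorphisms as maps of weight one *)

Definition edge_weight (R : nzSemiRingType) {T G : digraph} (o c : T)
    (a b : G) : R :=
  (if Defs.arc (parent o c) c then Defs.arc a b else Defs.arc b a)%:R.

(** Every arc of the tree joins some [c != o] to its parent, and it is the only
    arc between the two, so one test per vertex [c] covers each arc once. *)
Lemma is_hom_edges (T G : digraph) (o : T) (phi : {ffun T -> G}) :
    directed_tree T ->
  is_hom phi = [forall c, (c != o) ==>
    (if Defs.arc (parent o c) c then Defs.arc (phi (parent o c)) (phi c)
     else Defs.arc (phi c) (phi (parent o c)))].
Proof.
case=> anti treeT; apply/idP/idP.
  move=> hphi; apply/forallP => c; apply/implyP => cNo.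
  have hom x y : Defs.arc x y -> Defs.arc (phi x) (phi y).
    by have /forallP/(_ y)/implyP := forallP hphi x.
  have := uedge_parent _ _ _ treeT cNo; rewrite /uedge.
  by case: ifP => [/hom|_ /hom].
move=> /forallP H; apply/forallP => x; apply/forallP => y; apply/implyP => xy.
have /orP[] : (y != o) && (parent o y == x) || (x != o) && (parent o x == y).
- by apply: edge_parent => //; rewrite /uedge xy.
- by case/andP=> yo /eqP px; have := H y; rewrite yo px xy.
by case/andP=> xo /eqP py; have := H x; rewrite xo py (negPf (anti _ _ xy)).
Qed.

Lemma hom_count_sum (R : comNzSemiRingType) (T G : digraph) (o : T) (v : G) :
    directed_tree T ->
  (hom_count o v)%:R = \sum_(phi : {ffun T -> G} | phi o == v)
    \prod_(c | c != o) edge_weight R o c (phi (parent o c)) (phi c).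
Proof.
move=> hT; rewrite /hom_count -sum1_card natr_sum.
under eq_bigl do rewrite inE andbC.
rewrite big_mkcondr; apply: eq_bigr => phi _; rewrite (is_hom_edges _ _ o) //.
case: ifP => [/forallP H|/negbT].
  rewrite big1 // => c cNo; have := H c; rewrite cNo /edge_weight.
  by case: ifP => _ /= ->.
rewrite negb_forall => /existsP[c]; rewrite negb_imply => /andP[cNo Wc].
rewrite (bigD1 c) //= /edge_weight.
by move: Wc; case: ifP => _ /negPf ->; rewrite mul0r.
Qed.

Theorem proposition4p3 (R : realType) (T : digraph) (o : T)
    (hT : directed_tree T) (G : digraph) :
  exists F : T -> G -> R,
    [/\ forall (x : T) (v : G), 0 <= F x v,
        forall v : G, (hom_count o v)%:R = F o v,
        forall x : T, children o x = set0 -> forall v : G, F x v = 1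
      & forall x : T, children o x <> set0 -> forall v : G,
          F x v = (\prod_(c in ch_out o x) A_out (F c) v)
                  * (\prod_(c in ch_in o x) A_in (F c) v)].
Proof.
have [anti treeT] := hT.
have dpar (c : T) := gdist_parent T o c treeT.
pose F : T -> G -> R :=
  subtree_sum o (parent o) (edge_weight R o) #|T|.+1.
have FE (x : T) (v : G) := subtree_sum_rec R T G o (parent o) (edge_weight R o)
  (gdist (@uedge T) o) #|T| dpar (gdist_le_card _ _ o) x v.
exists F; split=> [x v|v|x leaf v|x _ v].
- by apply: subtree_sum_ge0 => c a b; apply: ler0n.
- by rewrite (hom_count_sum R) //; apply: sum_maps_recursion dpar FE.
- rewrite /F FE big_pred0 // => c.
  by rewrite -childrenE // leaf inE.
rewrite /F FE (bigID (fun c => Defs.arc x c)) /=; congr (_ * _).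
  apply: eq_big => [c|c /andP[/andP[_ /eqP px] xc]].
    by rewrite inE childrenE.
  rewrite /A_out [RHS]big_mkcond /=; apply: eq_bigr => u _.
  by rewrite /edge_weight px xc; case: ifP => _; rewrite ?mul1r ?mul0r.
apply: eq_big => [c|c /andP[/andP[_ /eqP px] xc]].
  rewrite inE childrenE //; apply: andb_id2l => /andP[cNo /eqP px].
  have := uedge_parent _ _ _ treeT cNo; rewrite px /uedge.
  by case: (boolP (Defs.arc x c)) => [/anti/negPf ->|_ /= ->].
rewrite /A_in [RHS]big_mkcond /=; apply: eq_bigr => u _.
by rewrite /edge_weight px (negPf xc); case: ifP => _; rewrite ?mul1r ?mul0r.
Qed.
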